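(* Let $f:\mathbb{R}^n\to\mathbb{R}$ be twice continuously differentiable with $\gamma$-Lipschitz continuous Hessian, and let $x_*$ be a minimizer of $f$. Let $\{x_t\}_{t\ge0}$ be generated by Algorithm INCR with $\eta_t=\gamma$ for all $t\ge0$, and assume that \[ 0\preceq H_t-\nabla^2 f(x_t)\preceq \mu_t I\qquad\forall t\ge0, \] where $0\le\mu_t\le\mu_u$ for some $\mu_u\ge0$. (a) If $f$ is strongly convex with parameter $\lambda>0$, then for any $t\ge0$, \[ f(x_{t+1})-f(x_* )\le(1-\alpha_t)\,(f(x_t)-f(x_* )),\qquad \alpha_t=\min\left\{\frac13,\ \frac{\lambda}{6\mu_t},\ \sqrt{\frac{2\lambda}{\gamma\|x_t-x_*\|}}\right\}. \] (b) If $f$ is only convex, and $\{\alpha_t\}_{t\ge 0}$ is chosen such that $\alpha_0=1$ and $\alpha_t\in(0,1)$ for all $t\ge1$, then for any $t\ge0$, \[ f(x_{t+1})-f(x_* )\le A_t\left[\sum_{i=0}^t\frac{\mu_i\alpha_i^2\|x_i-x_*\|^2}{A_i}+\gamma\sum_{i=0}^t\frac{\alpha_i^3\|x_i-x_*\|^3}{3A_i}\right], \] where $A_0=1$ and $A_t=\prod_{i=1}^t(1-\alpha_i)$ for $t\ge1$.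
   Context: $\|\cdot\|$ is the Euclidean norm for vectors and the spectral norm for matrices; $\preceq$ is the Loewner order. The Hessian of $f$ is $\gamma$-Lipschitz if $\|\nabla^2 f(x)-\nabla^2 f(x')\|\le\gamma\|x-x'\|$ for all $x,x'$. The function $f$ is strongly convex with parameter $\lambda\ge0$ if $f(\alpha x+(1-\alpha)x')\le\alpha f(x)+(1-\alpha)f(x')-\frac{\alpha(1-\alpha)\lambda}{2}\|x-x'\|^2$ for all $x,x'\in\mathbb{R}^n$, $\alpha\in[0,1]$; ''only convex'' means $\lambda=0$. In a minimum, a term with zero denominator is read as $+\infty$. Algorithm INCR (inexact Newton method with cubic regularization): given $x_0\in\mathbb{R}^n$ and a nonnegative sequence $\{\eta_t\}_{t\ge0}$, for $t=0,1,2,\dots$ choose a symmetric matrix $H_t\in\mathbb{R}^{n\times n}$ (an approximation of $\nabla^2 f(x_t)$) and let \[ x_{t+1}=\arg\min_{x\in\mathbb{R}^n}\tilde f_{\eta_t}(x;x_t),\qquad \tilde f_{\eta_t}(x;x_t)=f(x_t)+\langle\nabla f(x_t),x-x_t\rangle+\tfrac12\langle H_t(x-x_t),x-x_t\rangle+\tfrac{\eta_t}{6}\|x-x_t\|^3 . \] *)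

(* Defs.v *)
From mathcomp Require Import all_boot all_order all_algebra.
From mathcomp Require Import all_classical all_reals all_analysis.
Set Implicit Arguments. Unset Strict Implicit. Unset Printing Implicit Defensive.
Import Order.TTheory GRing.Theory Num.Theory.
Import numFieldNormedType.Exports.
Local Open Scope classical_set_scope.
Local Open Scope ring_scope.

Definition dotv (R : realType) (n : nat) (u v : 'cV[R]_n) : R :=
  \sum_(i < n) u i 0 * v i 0.

(* The library norm [`|v|] on matrices is the sup norm. It is used below only
   through the topology (differentiability, continuity), where the choice of
   norm is immaterial; all metric quantities use [enorm]. *)
Definition enorm (R : realType) (n : nat) (v : 'cV[R]_n) : R :=
  Num.sqrt (dotv v v).

Definition specnorm (R : realType) (n : nat) (A : 'M[R]_n) : R :=
  sup [set enorm (A *m v) | v in [set v : 'cV[R]_n | enorm v <= 1]].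

(* Symmetry is not part of the definition: it is only applied to matrices built
   from Hessians of C^2 functions, the symmetric matrices H_t and multiples of
   the identity. *)
Definition loewner_le (R : realType) (n : nat) (A B : 'M[R]_n) : Prop :=
  forall v : 'cV[R]_n, 0 <= dotv ((B - A) *m v) v.

Definition grad (R : realType) (n : nat) (f : 'cV[R]_n -> R) (x : 'cV[R]_n) :
    'cV[R]_n :=
  \col_(i < n) 'D_(delta_mx i 0) f x.

Definition hess (R : realType) (n : nat) (f : 'cV[R]_n -> R) (x : 'cV[R]_n) :
    'M[R]_n :=
  \matrix_(i < n, j < n) 'D_(delta_mx i 0) ('D_(delta_mx j 0) f) x.

Definition twice_continuously_differentiable (R : realType) (n : nat)
    (f : 'cV[R]_n -> R) : Prop :=
  [/\ forall x, differentiable f x,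
      forall x, differentiable (grad f) x
    & continuous (hess f)].

Definition hessian_lipschitz (R : realType) (n : nat) (gamma : R)
    (f : 'cV[R]_n -> R) : Prop :=
  forall x x', specnorm (hess f x - hess f x') <= gamma * enorm (x - x').

(* [lambda = 0] is plain convexity. *)
Definition strongly_convex (R : realType) (n : nat) (lambda : R)
    (f : 'cV[R]_n -> R) : Prop :=
  forall (x x' : 'cV[R]_n) (a : R), 0 <= a <= 1 ->
    f (a *: x + (1 - a) *: x') <=
      a * f x + (1 - a) * f x' - a * (1 - a) * lambda / 2 * enorm (x - x') ^+ 2.

Definition minimizer (R : realType) (n : nat) (f : 'cV[R]_n -> R)
    (x : 'cV[R]_n) : Prop :=
  forall y, f x <= f y.

Definition cubic_model (R : realType) (n : nat) (f : 'cV[R]_n -> R)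
    (H : 'M[R]_n) (eta : R) (xt x : 'cV[R]_n) : R :=
  f xt + dotv (grad f xt) (x - xt) + 2^-1 * dotv (H *m (x - xt)) (x - xt)
  + eta / 6 * enorm (x - xt) ^+ 3.

(* [x] is a run of the method: the argmin is read as any global minimizer. *)
Definition INCR (R : realType) (n : nat) (f : 'cV[R]_n -> R)
    (eta : nat -> R) (H : nat -> 'M[R]_n) (x : nat -> 'cV[R]_n) : Prop :=
  forall t : nat,
    [/\ 0 <= eta t, (H t)^T = H t
      & minimizer (cubic_model f (H t) (eta t) (x t)) (x t.+1)].

(* In the extended reals [0^-1 = +oo] and [sqrte +oo = +oo], so a term with zero
   denominator is [+oo] when [lambda > 0]; the minimum is at most 1/3 and is
   thus finite, so that [fine] loses nothing. *)
Definition rate (R : realType) (lambda mu gamma d : R) : R :=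
  fine (Order.min (3^-1)%:E
         (Order.min (lambda%:E / (6 * mu)%:E)
                    (sqrte ((2 * lambda)%:E / (gamma * d)%:E))))%E.

Definition decay (R : realType) (alpha : nat -> R) (t : nat) : R :=
  \prod_(1 <= i < t.+1) (1 - alpha i).

(* Main.v *)
Require Import Defs.
From mathcomp Require Import all_boot all_order all_algebra.
From mathcomp Require Import all_classical all_reals all_analysis.
From mathcomp Require Import ring lra.
Import Order.TTheory GRing.Theory Num.Theory.
Import numFieldNormedType.Exports.
Local Open Scope classical_set_scope.
Local Open Scope ring_scope.

(** Fix one step and write s = x_(t+1) - x_t, e = x_* - x_t, r = |s|, d = |e|,
    p = <s, e>, A for the Hessian of f at x_t and N = H_t - A.

    In the convex case the model is compared at its minimizer and at x_t + alpha e. As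
    the Hessian is gamma-Lipschitz and 0 <= N <= mu_t, f lies below the model at
    x_(t+1), and the model exceeds f by at most mu_t / 2 |v|^2 + gamma / 3 |v|^3 at
    x_t + v; with convexity this gives [convex_step], a linear recursion for the gaps,
    which [unroll_decay] solves.

    In the strongly convex case the same comparison gives the factor 1 - alpha only
    for alpha up to a multiple of sqrt (lambda / (gamma d)) smaller than the one
    claimed. It loses because it is sharp only if the Hessian grows as fast as allowed
    along s and decreases as fast as allowed along e, and these contradict each other
    when s is close to alpha e. To exploit this, the gradient of f at x_(t+1) is used
    too. With b = 2/5 alpha, o = 1 - b and tau = 3/8 alpha the proof of
    [strongly_convex_step] adds up
     - the tangent inequality at x_(t+1), read at x_*, with weight b;
     - the tangent inequality at x_t + tau e, read at x_*, with weight alpha - b, where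
       the value and the slope at x_t + tau e are bounded below together
       ([ray_value_ge]);
     - an upper bound for o times the Taylor remainder of f at x_(t+1) minus the
       remainder of the gradient there in the direction b (e - s). Both remainders
       are integrals of the same variation of the Hessian, and they are bounded as
       one integral ([kernel_value]).
    The gradient at x_t is eliminated by the optimality condition
    grad f x_t + H_t s + gamma / 2 r s = 0 ([cubic_model_stationary]). Then A occurs only
    through a positive semidefinite form, so it may be replaced by lambda, and N through
    - <N s, s> + alpha <N e, s> <= alpha^2 / 4 <N e, e> <= alpha^2 mu_t d^2 / 4. The sum
    says that the gap at x_(t+1) minus (1 - alpha) times the gap at x_t is at most
      - lambda / 2 (r^2 - 2 alpha p + alpha d^2) + mu_t alpha^2 d^2 / 4 + gamma G
    with G a polynomial in alpha, r, d and p, and [scalar_bound] shows that this is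
    nonpositive under the three upper bounds on alpha that define the rate ([rate_spec]). *)

Set Implicit Arguments.
Unset Strict Implicit.
Unset Printing Implicit Defensive.

(** * Euclidean inner product and norms *)

Section Vectors.
Variables (R : realType) (n : nat).
Implicit Types u v w : 'cV[R]_n.

Lemma dotvC u v : dotv u v = dotv v u.
Proof. by apply: eq_bigr => i _; rewrite mulrC. Qed.

Lemma dotvDl u v w : dotv (u + v) w = dotv u w + dotv v w.
Proof. by rewrite /dotv -big_split; apply: eq_bigr => i _; rewrite mxE mulrDl. Qed.

Lemma dotvZl (a : R) u v : dotv (a *: u) v = a * dotv u v.
Proof. by rewrite /dotv mulr_sumr; apply: eq_bigr => i _; rewrite mxE mulrA. Qed.

Lemma dotvNl u v : dotv (- u) v = - dotv u v.
Proof. by rewrite -scaleN1r dotvZl mulN1r. Qed.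

Lemma dotvDr u v w : dotv w (u + v) = dotv w u + dotv w v.
Proof. by rewrite dotvC dotvDl !(dotvC w). Qed.

Lemma dotvZr (a : R) u v : dotv v (a *: u) = a * dotv v u.
Proof. by rewrite dotvC dotvZl dotvC. Qed.

Lemma dotvNr u v : dotv v (- u) = - dotv v u.
Proof. by rewrite dotvC dotvNl dotvC. Qed.

Definition dotvE := (dotvDl, dotvDr, dotvNl, dotvNr, dotvZl, dotvZr).

Lemma dotvv_ge0 u : 0 <= dotv u u.
Proof. by apply: sumr_ge0 => i _; rewrite -expr2 sqr_ge0. Qed.

Lemma enorm_ge0 u : 0 <= enorm u.
Proof. exact: sqrtr_ge0. Qed.

Lemma enorm_sqr u : enorm u ^+ 2 = dotv u u.
Proof. by rewrite sqr_sqrtr // dotvv_ge0. Qed.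

Lemma enormZ (a : R) u : enorm (a *: u) = `|a| * enorm u.
Proof.
by rewrite /enorm !dotvE mulrA -expr2 sqrtrM ?sqr_ge0 // sqrtr_sqr.
Qed.

Lemma enormN u : enorm (- u) = enorm u.
Proof. by rewrite /enorm !dotvE opprK. Qed.

Lemma enorm0 : enorm (0 : 'cV[R]_n) = 0.
Proof. by rewrite -(scale0r 0) enormZ normr0 mul0r. Qed.

Lemma dotv_le u v : dotv u v <= enorm u * enorm v.
Proof.
have [u0|u0] := eqVneq (enorm u) 0.
  have z i : u i 0 = 0.
    have /eqP := enorm_sqr u; rewrite u0 expr0n /= eq_sym psumr_eq0; last first.
      by move=> j _; rewrite -expr2 sqr_ge0.
    by move=> /allP/(_ i (mem_index_enum _))/=; rewrite mulf_eq0 orbb => /eqP.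
  by rewrite u0 mul0r /dotv big1 // => i _; rewrite z mul0r.
have up : 0 < enorm u ^+ 2 by rewrite exprn_even_gt0.
apply: le_trans (ler_norm _) _; rewrite -ler_sqr ?nnegrE ?mulr_ge0 ?enorm_ge0 //.
rewrite real_normK ?num_real // exprMn.
have := dotvv_ge0 (enorm u ^+ 2 *: v - dotv u v *: u).
rewrite !dotvE (dotvC v u) -!enorm_sqr => h.
by rewrite -subr_ge0 -(pmulr_rge0 _ up); move: h; lra.
Qed.

Lemma dotv_norm_le u v : `|dotv u v| <= enorm u * enorm v.
Proof.
rewrite ler_norml dotv_le andbT lerNl -dotvNl -(enormN u); exact: dotv_le.
Qed.

Lemma enormD_le u v : enorm (u + v) <= enorm u + enorm v.
Proof.
rewrite -ler_sqr ?nnegrE ?addr_ge0 ?enorm_ge0 //.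
rewrite enorm_sqr !dotvE (dotvC v u) sqrrD !enorm_sqr.
have := dotv_le u v; lra.
Qed.

(** The spectral norm is a supremum in R, so it bounds anything only once the set is
    known to be bounded; the sum of the row norms is a crude bound. *)
Lemma enorm_mulmx_bounded (M : 'M[R]_n) :
  exists2 C : R, 0 <= C & forall v, enorm (M *m v) <= C * enorm v.
Proof.
exists (\sum_i enorm (row i M)^T); first by apply: sumr_ge0 => i _; exact: enorm_ge0.
move=> v; have e i : (M *m v) i 0 = dotv (row i M)^T v.
  by rewrite mxE; apply: eq_bigr => j _; rewrite !mxE.
suff h : enorm (M *m v) <= \sum_i `|(M *m v) i 0|.
  apply: (le_trans h); rewrite mulr_suml; apply: ler_sum => i _.
  by rewrite e; apply: dotv_norm_le.
move: (M *m v) => w {M v e}.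
rewrite -ler_sqr ?nnegrE ?enorm_ge0 ?sumr_ge0 //.
rewrite enorm_sqr expr2 mulr_suml; apply: ler_sum => i _.
rewrite -expr2 -real_normK ?num_real // expr2 ler_wpM2l //.
by rewrite (bigD1 i) //= lerDl sumr_ge0.
Qed.

Lemma enorm_mulmx_le (M : 'M[R]_n) v : enorm (M *m v) <= specnorm M * enorm v.
Proof.
have [C C0 hC] := enorm_mulmx_bounded M.
have hs : has_sup [set enorm (M *m v) | v in [set v : 'cV[R]_n | enorm v <= 1]].
  split; first by exists (enorm (M *m 0)), 0 => //=; rewrite enorm0.
  exists C => _ [w /= w1 <-]; apply: (le_trans (hC w)).
  by rewrite -[leRHS]mulr1 ler_wpM2l.
have [v0|v0] := eqVneq (enorm v) 0.
  by have := hC v; rewrite v0 !mulr0.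
have vp : 0 < enorm v by rewrite lt_neqAle eq_sym v0 enorm_ge0.
rewrite -ler_pdivrMr //; apply: sup_upper_bound => //.
exists ((enorm v)^-1 *: v) => /=.
  by rewrite enormZ ger0_norm ?invr_ge0 ?enorm_ge0 // mulVf.
by rewrite -scalemxAr enormZ ger0_norm ?invr_ge0 ?enorm_ge0 // mulrC.
Qed.

End Vectors.

(** * Derivatives and Taylor estimates in one variable *)

Section Calculus.
Variable R : realType.
Implicit Types f g : R -> R.

(** A plain definition over [is_derive], which is a class: instance resolution would
    produce derivatives written with [*:], out of reach of [ring]. *)
Definition has_deriv (f : R -> R) (t a : R) : Prop := is_derive t (1 : R) f a.

Lemma has_deriv_eq f (t a b : R) : has_deriv f t a -> a = b -> has_deriv f t b.
Proof. by move=> fa <-. Qed.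

Lemma has_deriv_cst (c t : R) : has_deriv (fun=> c) t 0.
Proof. exact: is_derive_cst. Qed.

Lemma has_deriv_id (t : R) : has_deriv (fun x => x) t 1.
Proof. exact: is_derive_id. Qed.

Lemma has_derivD f g (t a b : R) : has_deriv f t a -> has_deriv g t b ->
  has_deriv (fun x => f x + g x) t (a + b).
Proof. by move=> ? ?; exact: is_deriveD. Qed.

Lemma has_derivN f (t a : R) : has_deriv f t a -> has_deriv (fun x => - f x) t (- a).
Proof. by move=> ?; exact: is_deriveN. Qed.

Lemma has_derivM f g (t a b : R) : has_deriv f t a -> has_deriv g t b ->
  has_deriv (fun x => f x * g x) t (f t * b + g t * a).
Proof. by move=> ? ?; exact: is_deriveM. Qed.

Lemma has_derivX f k (t a : R) : has_deriv f t a ->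
  has_deriv (fun x => f x ^+ k) t (k%:R * f t ^+ k.-1 * a).
Proof.
rewrite /has_deriv => fa; rewrite (_ : (fun x => _) = f ^+ k); last first.
  by apply/funext => x; rewrite exprfctE.
exact: is_derive_eq.
Qed.

Lemma derive_nonpos_le f (df : R -> R) (a b : R) : a <= b ->
  (forall t, has_deriv f t (df t)) ->
  (forall t, a <= t <= b -> df t <= 0) -> f b <= f a.
Proof.
move=> ab fD df0.
have [|c cab e] := MVT_segment ab (fun x _ => fD x).
  apply: continuous_subspaceT => x; apply: differentiable_continuous.
  by apply/derivable1_diffP; by case: (fD x).
by rewrite -subr_le0 e mulr_le0_ge0 ?subr_ge0 // df0.
Qed.

Lemma le_of_le_add_eps (a b c : R) : (forall e, 0 < e <= 1 -> a <= b + c * e) -> a <= b.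
Proof.
move=> h; rewrite leNgt; apply/negP => ba.
have c0 : 0 < c by have := h 1; rewrite ltr01 lexx => /(_ isT); lra.
pose e := Num.min 1 ((a - b) / (2 * c)).
have e0 : 0 < e <= 1.
  by rewrite /e lt_min ltr01 divr_gt0 ?subr_gt0 ?mulr_gt0 //= ge_min lexx.
have : c * e <= (a - b) / 2.
  have : e <= (a - b) / (2 * c) by rewrite ge_min lexx orbT.
  rewrite -(ler_pM2l c0) => /le_trans; apply.
  have -> // : c * ((a - b) / (2 * c)) = (a - b) / 2 by field; rewrite gt_eqF.
by have := h e e0; lra.
Qed.

Lemma has_deriv_comp f g (t a b : R) : has_deriv f (g t) a -> has_deriv g t b ->
  has_deriv (fun x => f (g x)) t (a * b).
Proof. exact: is_derive1_comp. Qed.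

Lemma has_deriv_shift f (e t a : R) : has_deriv f (t + e) a ->
  has_deriv (fun x => f (x + e)) t a.
Proof.
move=> fa; rewrite -[a]mulr1; apply: (@has_deriv_comp f (fun x => x + e)) => //.
rewrite -[1]addr0; exact: has_derivD (has_deriv_id t) (has_deriv_cst e t).
Qed.

End Calculus.

Ltac derive_by := apply: has_deriv_eq;
  [repeat first [ exact: has_deriv_cst | exact: has_deriv_id | eassumption
    | apply: has_derivX | apply: has_derivN | apply: has_derivM | apply: has_derivD ] | ].

Section OneVariable.
Variables (R : realType) (F G h : R -> R) (L : R).
Hypothesis GD : forall t, has_deriv G t (h t).

Lemma taylor1_le : (forall t, 0 <= t <= 1 -> h t - h 0 <= L * t) ->
  G 1 - G 0 - h 0 <= L / 2.
Proof.
move=> hL; pose phi t := G t + - (t * h 0) + - (t ^+ 2 * (L / 2)).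
have D t : has_deriv phi t (h t - h 0 - t * L).
  by have := GD t => ?; derive_by; rewrite /=; field.
have : phi 1 <= phi 0.
  by apply: derive_nonpos_le D _ => // t /hL; lra.
by rewrite /phi; lra.
Qed.

Hypothesis FD : forall t, has_deriv F t (G t).

Lemma taylor2_le : (forall t, 0 <= t <= 1 -> h t - h 0 <= L * t) ->
  F 1 - F 0 - G 0 - h 0 / 2 <= L / 6.
Proof.
move=> hL.
have GL t : 0 <= t <= 1 -> G t - G 0 - t * h 0 <= L / 2 * t ^+ 2.
  move=> t01; pose phi t := G t + - (t * h 0) + - (t ^+ 2 * (L / 2)).
  have D u : has_deriv phi u (h u - h 0 - u * L).
    by have := GD u => ?; derive_by; rewrite /=; field.
  have : phi t <= phi 0.
    apply: derive_nonpos_le D _ => //; first by case/andP: t01.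
    move=> u /andP[u0 ut].
    have u1 : u <= 1 by apply: le_trans ut _; case/andP: t01.
    by have := hL u; rewrite u0 u1 => /(_ isT); lra.
  by rewrite /phi; lra.
pose phi t := F t + - (t * G 0) + - (t ^+ 2 * (h 0 / 2)) + - (t ^+ 3 * (L / 6)).
have D t : has_deriv phi t (G t - G 0 - t * h 0 - L / 2 * t ^+ 2).
  by have := FD t => ?; derive_by; rewrite /=; field.
have : phi 1 <= phi 0.
  by apply: derive_nonpos_le D _ => // t /GL; lra.
by rewrite /phi; lra.
Qed.

(** The derivative of F t + (1 - t) G t is (1 - t) h t, so one integration carries
    both the value and the slope at tau. Their sum is the tangent at tau read at
    time 1, which is how a convexity inequality at tau uses them. *)
Lemma ray_lower_bound (tau : R) : 0 <= tau <= 1 ->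
  (forall t, 0 <= t <= 1 -> h 0 - h t <= L * t) ->
  F 0 + G 0 + (tau - tau ^+ 2 / 2) * h 0 - (tau ^+ 2 / 2 - tau ^+ 3 / 3) * L
    <= F tau + (1 - tau) * G tau.
Proof.
move=> /andP[tau0 tau1] hL.
pose phi t := (t + - (t ^+ 2 / 2)) * h 0 + - ((t ^+ 2 / 2 + - (t ^+ 3 / 3)) * L)
  + - (F t + (1 + - t) * G t).
have D t : has_deriv phi t ((1 - t) * (h 0 - L * t - h t)).
  by have := FD t; have := GD t => ? ?; derive_by; rewrite /=; field.
have : phi tau <= phi 0.
  apply: derive_nonpos_le D _ => // t /andP[t0 tt].
  have t1 : t <= 1 by apply: le_trans tt _.
  by rewrite mulr_ge0_le0 ?subr_ge0 //; have := hL t; rewrite t0 t1 => /(_ isT); lra.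
by rewrite /phi; lra.
Qed.

End OneVariable.

(** ** A joint bound for the Taylor remainders of a function and of its gradient *)

Section Kernel.
Variables (R : realType) (F S B hS hB : R -> R) (om C m0 m1 m2 : R).
Hypothesis FD : forall t, has_deriv F t (S t).
Hypothesis SD : forall t, has_deriv S t (hS t).
Hypothesis BD : forall t, has_deriv B t (hB t).
Hypothesis om01 : 0 <= om <= 1.
Hypothesis C0 : 0 <= C.
Hypothesis hSC : forall s t, s <= t -> `|hS t - hS s| <= C * (t - s).
Hypothesis hBC : forall s t, s <= t -> `|hB t - hB s| <= C * (t - s).
Hypothesis hL : forall k s t, s <= t ->
  k * (hS t - hS s) - (hB t - hB s) <= (m0 + m1 * k + m2 * k ^+ 2) * (t - s).

(** Integration by parts writes the left-hand side as the integral over [0, 1] of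
    (1 - u) (om (1 - u) / 2 dhS - dhB), where dhS and dhB are the differentials of
    hS and hB. The bound [hL] on their increments with k = om (1 - u) / 2 then gives
    the integral of (1 - u) (m0 + m1 k + m2 k^2). As hS and hB are only Lipschitz,
    the integration by parts is done with the difference quotients of S and B,
    whose derivatives are difference quotients of hS and hB; their distance to hS
    and hB is O(e). *)
Lemma kernel_bound :
  om * (F 1 - F 0 - S 0 - hS 0 / 2) - (B 1 - B 0 - hB 0)
    <= m0 / 2 + m1 * om / 6 + m2 * om ^+ 2 / 16.
Proof.
have [om0 om1] := andP om01.
apply: (@le_of_le_add_eps _ _ _ (3 * C)) => e /andP[e0 _].
have quot (G h : R -> R) u : (forall t, has_deriv G t (h t)) ->
    (forall s t, s <= t -> `|h t - h s| <= C * (t - s)) ->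
    `|(G (u + e) - G u) / e - h u| <= C * e / 2.
  move=> GD hC.
  have D t : has_deriv (fun t => G (u + e * t)) t (e * h (u + e * t)).
    rewrite mulrC; apply: has_deriv_comp; first exact: GD.
    by derive_by; rewrite /=; ring.
  have D' t : has_deriv (fun t => - G (u + e * t)) t (- (e * h (u + e * t))).
    by apply: has_derivN.
  have hh t : 0 <= t <= 1 -> `|e * h (u + e * t) - e * h (u + e * 0)| <= C * e ^+ 2 * t.
    move=> /andP[t0 t1]; rewrite -mulrBr normrM gtr0_norm //.
    have := hC (u + e * 0) (u + e * t).
    rewrite lerD2l ler_pM2l // => /(_ t0).
    rewrite -(ler_pM2l e0) => /le_trans; apply.
    by rewrite le_eqVlt; apply/orP; left; apply/eqP; ring.
  have U := taylor1_le (L := C * e ^+ 2) D.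
  have U' := taylor1_le (L := C * e ^+ 2) D'.
  have {}U := U (fun t t01 => le_trans (ler_norm _) (hh t t01)).
  have {}U' : - G (u + e * 1) - - G (u + e * 0) - - (e * h (u + e * 0)) <= C * e ^+ 2 / 2.
    apply: U' => t /hh; rewrite distrC => /(le_trans (ler_norm _)); lra.
  rewrite mulr1 mulr0 addr0 in U U'.
  rewrite ler_norml; apply/andP; split.
    rewrite -(ler_pM2l e0) mulrBr [e * (_ / e)]mulrC divfK ?gt_eqF //; lra.
  rewrite -(ler_pM2l e0) mulrBr [e * (_ / e)]mulrC divfK ?gt_eqF //; lra.
(* Antiderivative of the integrand, in the variable w = 1 - u. *)
pose I w := m0 * (w ^+ 2 / 2) + m1 * om * (w ^+ 3 / 6) + m2 * om ^+ 2 * (w ^+ 4 / 16).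
pose dS u := (S (u + e) + - S u) * e^-1.
pose dB u := (B (u + e) + - B u) * e^-1.
(* The first three terms differentiate to om (1 - u) hS - hB, the next two replace
   hS and hB by their increments, the last one pays for the O(e) errors. *)
pose phi u := om * (1 + - u) * S u + - B u + om * F u
  + (om / 2 * (1 + - u) ^+ 2 * dS u + - ((1 + - u) * dB u)) + I (1 + - u)
  + - (2 * C * e * u).
pose dhS u := (hS (u + e) - hS u) / e.
pose dhB u := (hB (u + e) - hB u) / e.
have D u : has_deriv phi u
   (om * (1 - u) * (hS u - dS u) + (dB u - hB u)
    + ((1 - u) * (om * (1 - u) / 2 * dhS u - dhB u)
       - (1 - u) * (m0 + m1 * (om * (1 - u) / 2) + m2 * (om * (1 - u) / 2) ^+ 2))
    - 2 * C * e).
  have := SD u; have := BD u; have := FD u.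
  have := has_deriv_shift (SD (u + e)); have := has_deriv_shift (BD (u + e)).
  move=> ? ? ? ? ?; rewrite /phi /I; derive_by.
  by rewrite /dhS /dhB /dS /dB /=; field; rewrite gt_eqF.
have hphi : phi 1 <= phi 0.
  apply: derive_nonpos_le D _ => // u /andP[u0 u1].
  have u1' : 0 <= 1 - u by rewrite subr_ge0.
  have := quot S hS u SD hSC; have := quot B hB u BD hBC.
  rewrite -/(dS u) -/(dB u) !ler_norml => /andP[b1 b2] /andP[s1 s2].
  have k1 : om * (1 - u) * (hS u - dS u) <= C * e / 2.
    have p0 : 0 <= om * (1 - u) by rewrite mulr_ge0.
    have p1 : om * (1 - u) <= 1 by rewrite mulr_ile1 //; lra.
    apply: (@le_trans _ _ (om * (1 - u) * (C * e / 2))); first by rewrite ler_wpM2l //; lra.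
    by rewrite -[leRHS]mul1r ler_wpM2r // !mulr_ge0 // ltW.
  have k2 : om * (1 - u) / 2 * dhS u - dhB u
     <= m0 + m1 * (om * (1 - u) / 2) + m2 * (om * (1 - u) / 2) ^+ 2.
    have := hL (om * (1 - u) / 2) (s := u) (t := u + e).
    rewrite lerDl (ltW e0) (_ : u + e - u = e); last by ring.
    move=> /(_ isT); rewrite -ler_pdivrMr // => /(le_trans _); apply.
    by rewrite le_eqVlt; apply/orP; left; apply/eqP; rewrite /dhS /dhB; field; rewrite gt_eqF.
  have : (1 - u) * (om * (1 - u) / 2 * dhS u - dhB u)
       <= (1 - u) * (m0 + m1 * (om * (1 - u) / 2) + m2 * (om * (1 - u) / 2) ^+ 2).
    by rewrite ler_wpM2l.
  have := mulr_ge0 C0 (ltW e0).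
  lra.
have := quot S hS 0 SD hSC; have := quot B hB 0 BD hBC.
rewrite -/(dS 0) -/(dB 0) !ler_norml => /andP[b1 b2] /andP[s1 s2].
have k3 : om / 2 * (dS 0 - hS 0) <= C * e / 2.
  have := mulr_ge0 C0 (ltW e0) => Ce.
  apply: (@le_trans _ _ (om / 2 * (C * e / 2))).
    by rewrite ler_wpM2l ?divr_ge0.
  by rewrite -[leRHS]mul1r ler_wpM2r //; lra.
have Ce := mulr_ge0 C0 (ltW e0).
move: hphi k3 b1; rewrite /phi /I; lra.
Qed.
End Kernel.

(** * Taylor estimates for a function with Lipschitz Hessian *)

Section C2.
Variables (R : realType) (n : nat) (f : 'cV[R]_n -> R).
Implicit Types x v b : 'cV[R]_n.

Lemma has_deriv_line (F : 'cV[R]_n -> R) x v (t : R) :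
  differentiable F (x + t *: v) ->
  has_deriv (fun u => F (x + u *: v)) t ('D_v F (x + t *: v)).
Proof.
move=> dF.
have e : (fun h : R => h^-1 *: ((fun u => F (x + u *: v)) (h *: (1:R) + t) - F (x + t *: v)))
  = (fun h => h^-1 *: (F (h *: v + (x + t *: v)) - F (x + t *: v))).
  apply/funext => h; congr (_ *: (F _ - _)).
  by rewrite scalerDl /GRing.scale /= mulr1 addrCA.
have dv : derivable F (x + t *: v) v by exact: diff_derivable.
apply: DeriveDef; first by rewrite /derivable /= e.
by rewrite /derive /= e.
Qed.

Lemma derive_sum_partial (F : 'cV[R]_n -> R) x v : differentiable F x ->
  'D_v F x = \sum_i v i 0 * 'D_(delta_mx i 0) F x.
Proof.
move=> dF; rewrite deriveE //.
have -> : v = \sum_i v i 0 *: delta_mx i 0.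
  by rewrite {1}[v]matrix_sum_delta; apply: eq_bigr => i _; rewrite big_ord1.
rewrite linear_sum /=; apply: eq_bigr => i _.
rewrite linearZ /= deriveE //; congr (_ * _).
rewrite summxE (bigD1 i) //= big1 ?addr0; last first.
  by move=> j ji; rewrite !mxE eq_sym (negbTE ji) mulr0.
by rewrite !mxE !eqxx mulr1.
Qed.

Hypothesis fC2 : twice_continuously_differentiable f.

Lemma has_deriv_f_line x v (t : R) :
  has_deriv (fun u => f (x + u *: v)) t (dotv (grad f (x + t *: v)) v).
Proof.
have [df _ _] := fC2.
suff <- : 'D_v f (x + t *: v) = dotv (grad f (x + t *: v)) v.
  exact/has_deriv_line/df.
rewrite derive_sum_partial // dotvC; apply: eq_bigr => i _; by rewrite mxE.
Qed.

Lemma has_deriv_grad_line x v b (t : R) :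
  has_deriv (fun u => dotv (grad f (x + u *: v)) b) t
    (dotv (hess f (x + t *: v) *m b) v).
Proof.
have [_ dg _] := fC2.
pose F (i : 'I_n) : 'cV[R]_n -> R := 'D_(delta_mx i 0) f.
have FE i : F i = (fun M : 'cV[R]_n => M i 0) \o grad f.
  by apply/funext => y /=; rewrite mxE.
have dF i y : differentiable (F i) y.
  by rewrite FE; apply: differentiable_comp; [exact: dg | exact: differentiable_coord].
have -> : (fun u => dotv (grad f (x + u *: v)) b) =
   \sum_(i < n) (fun u => b i 0 * F i (x + u *: v)).
  apply/funext => u; rewrite fct_sumE; apply: eq_bigr => i _.
  by rewrite mxE mulrC.
have h i : has_deriv (fun u => b i 0 * F i (x + u *: v)) t
    (b i 0 * 'D_v (F i) (x + t *: v) + F i (x + t *: v) * 0).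
  exact: (has_derivM (has_deriv_cst (b i 0) t) (has_deriv_line (dF i (x + t *: v)))).
suff <- : \sum_(i < n) (b i 0 * 'D_v (F i) (x + t *: v) + F i (x + t *: v) * 0)
    = dotv (hess f (x + t *: v) *m b) v by exact: is_derive_sum.
rewrite /dotv.
under eq_bigr => i _ do rewrite mulr0 addr0 derive_sum_partial // mulr_sumr.
rewrite exchange_big; apply: eq_bigr => j _; rewrite mxE mulr_suml.
by apply: eq_bigr => i _; rewrite !mxE /F; ring.
Qed.

End C2.

Section Taylor.
Variables (R : realType) (n : nat) (f : 'cV[R]_n -> R) (gamma : R).
Hypothesis fC2 : twice_continuously_differentiable f.
Hypothesis flip : hessian_lipschitz gamma f.
Hypothesis gamma0 : 0 <= gamma.
Implicit Types x u v b s : 'cV[R]_n.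

Local Notation dgrad x v := (dotv (grad f x) v).
Local Notation dhess x u v := (dotv (hess f x *m u) v).

Lemma hess_lip x y u v :
  `|dhess y u v - dhess x u v| <= gamma * enorm (y - x) * enorm u * enorm v.
Proof.
rewrite -dotvNl -dotvDl -mulmxBl; apply: (le_trans (dotv_norm_le _ _)).
rewrite ler_wpM2r ?enorm_ge0 //; apply: (le_trans (enorm_mulmx_le _ _)).
by rewrite ler_wpM2r ?enorm_ge0.
Qed.

Lemma hess_lip_line x u v b (p q : R) : p <= q ->
  `|dhess (x + q *: v) u b - dhess (x + p *: v) u b|
    <= gamma * enorm v * enorm u * enorm b * (q - p).
Proof.
move=> pq; apply: (le_trans (hess_lip _ _ _ _)).
have -> : x + q *: v - (x + p *: v) = (q - p) *: v.
  by rewrite opprD addrACA subrr add0r scalerBl.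
rewrite enormZ ger0_norm ?subr_ge0 // le_eqVlt; apply/orP; left; apply/eqP.
by move: (enorm u) (enorm v) (enorm b) => U V B; ring.
Qed.

Lemma hess_lip_line0 x u v b (t : R) : 0 <= t ->
  `|dhess (x + t *: v) u b - dhess x u b|
    <= gamma * enorm v * enorm u * enorm b * t.
Proof. by move/(hess_lip_line x u v b); rewrite scale0r addr0 subr0. Qed.

Lemma taylor_grad x v b :
  dgrad (x + v) b - dgrad x b - dhess x b v <= gamma / 2 * enorm v ^+ 2 * enorm b.
Proof.
have D := has_deriv_grad_line fC2 x v b.
have hL t : 0 <= t <= 1 -> dhess (x + t *: v) b v - dhess (x + 0 *: v) b v
    <= gamma * enorm v ^+ 2 * enorm b * t.
  rewrite scale0r addr0 => /andP[t0 _]; apply: (le_trans (ler_norm _)).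
  apply: (le_trans (hess_lip_line0 _ _ _ _ t0)).
  rewrite le_eqVlt; apply/orP; left; apply/eqP.
  by move: (enorm v) (enorm b) => V B; ring.
have := taylor1_le D hL; rewrite /= scale1r scale0r addr0 => /le_trans; apply.
rewrite le_eqVlt; apply/orP; left; apply/eqP.
by move: (enorm v) (enorm b) => V B; ring.
Qed.

Lemma taylor_value_le x v :
  f (x + v) - f x - dgrad x v - dhess x v v / 2 <= gamma / 6 * enorm v ^+ 3.
Proof.
have D := has_deriv_grad_line fC2 x v v.
have DF := has_deriv_f_line fC2 x v.
have hL t : 0 <= t <= 1 -> dhess (x + t *: v) v v - dhess (x + 0 *: v) v v
    <= gamma * enorm v ^+ 3 * t.
  rewrite scale0r addr0 => /andP[t0 _]; apply: (le_trans (ler_norm _)).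
  apply: (le_trans (hess_lip_line0 _ _ _ _ t0)).
  rewrite le_eqVlt; apply/orP; left; apply/eqP.
  by move: (enorm v) => V; ring.
have := taylor2_le D DF hL; rewrite /= scale1r scale0r addr0 => /le_trans; apply.
rewrite le_eqVlt; apply/orP; left; apply/eqP.
by move: (enorm v) => V; ring.
Qed.

Lemma taylor_value_ge x v :
  - (gamma / 6 * enorm v ^+ 3) <= f (x + v) - f x - dgrad x v - dhess x v v / 2.
Proof.
have D t := has_derivN (has_deriv_grad_line fC2 x v v t).
have DF t := has_derivN (has_deriv_f_line fC2 x v t).
have hL t : 0 <= t <= 1 -> - dhess (x + t *: v) v v - - dhess (x + 0 *: v) v v
    <= gamma * enorm v ^+ 3 * t.
  rewrite scale0r addr0 => /andP[t0 _]; rewrite -opprD; apply: (le_trans (ler_norm _)).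
  rewrite normrN; apply: (le_trans (hess_lip_line0 _ _ _ _ t0)).
  rewrite le_eqVlt; apply/orP; left; apply/eqP.
  by move: (enorm v) => V; ring.
have := taylor2_le D DF hL; rewrite /= scale1r scale0r addr0.
move: (enorm v) (f (x + v)) (f x) (dgrad x v) (dhess x v v) => V a b c d; lra.
Qed.

Lemma ray_value_ge x e (tau : R) : 0 <= tau <= 1 ->
  f x + dgrad x e + (tau - tau ^+ 2 / 2) * dhess x e e
     - (tau ^+ 2 / 2 - tau ^+ 3 / 3) * (gamma * enorm e ^+ 3)
   <= f (x + tau *: e) + (1 - tau) * dgrad (x + tau *: e) e.
Proof.
move=> tau01.
have D := has_deriv_grad_line fC2 x e e.
have DF := has_deriv_f_line fC2 x e.
have hL t : 0 <= t <= 1 -> dhess (x + 0 *: e) e e - dhess (x + t *: e) e e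
    <= gamma * enorm e ^+ 3 * t.
  rewrite scale0r addr0 => /andP[t0 _]; apply: (le_trans (ler_norm _)).
  rewrite distrC; apply: (le_trans (hess_lip_line0 _ _ _ _ t0)).
  rewrite le_eqVlt; apply/orP; left; apply/eqP.
  by move: (enorm e) => V; ring.
by have := ray_lower_bound D DF tau01 hL; rewrite /= scale0r addr0.
Qed.

(** The remainders of f along s and of the gradient in direction b come from the same
    variation of the Hessian on the segment, and the increment of Hess f s is
    tested against om (1 - u) / 2 s - b: when b points the way of s the two effects
    cancel in part, which separate Taylor estimates would not see. The norm of that
    vector is made polynomial by r |z| <= |z|^2 / (2 m) + m r^2 / 2. *)
Lemma kernel_value x s b (om m : R) : 0 <= om <= 1 -> 0 < m ->
  om * (f (x + s) - f x - dgrad x s - dhess x s s / 2)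
    - (dgrad (x + s) b - dgrad x b - dhess x b s)
  <= gamma * enorm s * ((om ^+ 2 / 16 * enorm s ^+ 2 - om / 3 * dotv s b
        + enorm b ^+ 2 / 2) / (2 * m) + m / 4 * enorm s ^+ 2).
Proof.
move=> om01 m0.
have FD := has_deriv_f_line fC2 x s.
have SD := has_deriv_grad_line fC2 x s s.
have BD := has_deriv_grad_line fC2 x s b.
pose r := enorm s; pose q := dotv s b.
have r0 : 0 <= r := enorm_ge0 s.
pose C := gamma * r * r * (r + enorm b).
have C0 : 0 <= C by rewrite !mulr_ge0 // ?addr_ge0 ?enorm_ge0.
have hC u p t : p <= t -> enorm u <= r + enorm b ->
    `|dhess (x + t *: s) u s - dhess (x + p *: s) u s| <= C * (t - p).
  move=> pt hu; apply: (le_trans (hess_lip_line x u s s pt)).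
  rewrite ler_wpM2r ?subr_ge0 // /C -/r [leLHS]mulrAC ler_wpM2l //.
  by rewrite !mulr_ge0.
have rs : enorm s <= r + enorm b by rewrite lerDl enorm_ge0.
have rb : enorm b <= r + enorm b by rewrite lerDr.
have hS p t (pt : p <= t) := hC s p t pt rs.
have hB p t (pt : p <= t) := hC b p t pt rb.
pose k0 := gamma * r * (enorm b ^+ 2 / (2 * m) + m * r ^+ 2 / 2).
pose k1 := - (gamma * r * (2 * q / (2 * m))).
pose k2 := gamma * r * (r ^+ 2 / (2 * m)).
have hL k p t : p <= t ->
   k * (dhess (x + t *: s) s s - dhess (x + p *: s) s s)
     - (dhess (x + t *: s) b s - dhess (x + p *: s) b s)
   <= (k0 + k1 * k + k2 * k ^+ 2) * (t - p).
  move=> pt; have := hess_lip_line x (k *: s - b) s s pt.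
  move=> /(le_trans (ler_norm _)) h.
  have {h} : k * (dhess (x + t *: s) s s - dhess (x + p *: s) s s)
     - (dhess (x + t *: s) b s - dhess (x + p *: s) b s)
    <= gamma * r * enorm (k *: s - b) * r * (t - p).
    have lin (M N : 'M[R]_n) :
        dotv (M *m (k *: s - b)) s - dotv (N *m (k *: s - b)) s
        = k * (dotv (M *m s) s - dotv (N *m s) s)
          - (dotv (M *m b) s - dotv (N *m b) s).
      by rewrite !mulmxBr -!scalemxAr !dotvE; ring.
    by rewrite -(lin (hess f (x + t *: s)) (hess f (x + p *: s))).
  move=> /le_trans; apply; rewrite ler_wpM2r ?subr_ge0 //.
  have z : enorm (k *: s - b) ^+ 2 = k ^+ 2 * r ^+ 2 - 2 * k * q + enorm b ^+ 2.
    by rewrite enorm_sqr !dotvE (dotvC b s) -!enorm_sqr -/r -/q; ring.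
  have -> : k0 + k1 * k + k2 * k ^+ 2
     = gamma * r * (enorm (k *: s - b) ^+ 2 / (2 * m) + m * r ^+ 2 / 2).
    by rewrite z /k0 /k1 /k2; move: (enorm b) => B; field; rewrite gt_eqF.
  rewrite -[leLHS]mulrA ler_wpM2l ?mulr_ge0 //.
  move: (enorm (k *: s - b)) => Z.
  have : 0 <= (Z - m * r) ^+ 2 / (2 * m) by rewrite divr_ge0 ?sqr_ge0 ?mulr_ge0 // ltW.
  rewrite (_ : _ / _ = Z ^+ 2 / (2 * m) + m * r ^+ 2 / 2 - Z * r); last first.
    by field; rewrite gt_eqF.
  by rewrite subr_ge0.
have := kernel_bound FD SD BD om01 C0 hS hB hL.
rewrite /= scale1r scale0r addr0 => /le_trans; apply.
rewrite le_eqVlt; apply/orP; left; apply/eqP; rewrite /k0 /k1 /k2 -/r -/q.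
by move: (enorm b) => B; field; rewrite gt_eqF.
Qed.

(** Expanding f (x + t w + t z) at x, and through x + t w, gives two third order
    expansions; their t^2 coefficients agree only if the Hessian is symmetric. *)
Lemma hess_sym x u v : dhess x u v = dhess x v u.
Proof.
suff le w z : dhess x w z <= dhess x z w by apply/eqP; rewrite eq_le !le.
pose K := gamma * (enorm (w + z) ^+ 3 / 6 + enorm z ^+ 3 / 6 + enorm w ^+ 3 / 6
  + enorm w ^+ 2 * enorm z / 2 + enorm w * enorm z ^+ 2 / 2).
apply: (@le_of_le_add_eps _ _ _ (2 * K)) => t /andP[t0 _].
have t0' := ltW t0.
have h1 := taylor_value_ge x (t *: (w + z)).
have h2 := taylor_value_le x (t *: w).
have h3 := taylor_value_le (x + t *: w) (t *: z).
have h4 := taylor_grad x (t *: w) (t *: z).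
have h5 := le_trans (ler_norm _) (hess_lip_line0 x (t *: z) w (t *: z) t0').
rewrite (_ : x + t *: (w + z) = x + t *: w + t *: z) in h1; last first.
  by rewrite scalerDr addrA.
rewrite /K; move: h1 h2 h3 h4 h5.
move: (f (x + _ + _)) (f (x + _)) (f x) (hess f x) (hess f (x + _)) (grad f x)
  (grad f (x + _)) => F2 F1 F0 A A' g g'.
rewrite -!scalemxAr mulmxDr !dotvE !enormZ !ger0_norm //.
move: (enorm _) (enorm w) (enorm z) => E W Z.
move: (dotv g' z) (dotv g w) (dotv g z) (dotv (A' *m z) z) (dotv (A *m w) w)
  (dotv (A *m z) z) (dotv (A *m w) z) (dotv (A *m z) w).
move=> gz' gw gz Bzz' Bww Bzz Bwz Bzw h1 h2 h3 h4 h5.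
set k := gamma * _.
suff : 0 <= t ^+ 2 * (Bzw + 2 * k * t - Bwz).
  by rewrite pmulr_rge0 ?exprn_gt0 // subr_ge0.
rewrite /k; lra.
Qed.
End Taylor.

(** * Strong convexity in differential form *)

Section Convex.
Variables (R : realType) (n : nat) (f : 'cV[R]_n -> R) (gamma lambda : R).
Hypothesis fC2 : twice_continuously_differentiable f.
Hypothesis flip : hessian_lipschitz gamma f.
Hypothesis gamma0 : 0 <= gamma.
Hypothesis fconv : strongly_convex lambda f.
Implicit Types x v z : 'cV[R]_n.
Local Notation dgrad x v := (dotv (grad f x) v).
Local Notation dhess x u v := (dotv (hess f x *m u) v).

(** Convexity between x and x + v at x + a v, divided by a: the Taylor estimate at
    x + a v makes the error O(a). *)
Lemma strongly_convex_tangent x v :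
  f x + dgrad x v + lambda / 2 * enorm v ^+ 2 <= f (x + v).
Proof.
pose K := lambda / 2 * enorm v ^+ 2 + `|dhess x v v| / 2 + gamma / 6 * enorm v ^+ 3.
apply: (@le_of_le_add_eps _ _ _ K) => a /andP[a0 a1].
have := fconv (x + v) x (a := a); rewrite (ltW a0) a1 => /(_ isT).
have -> : a *: (x + v) + (1 - a) *: x = x + a *: v.
  by rewrite scalerDr scalerBl scale1r addrC addrA subrK.
have -> : x + v - x = v by rewrite addrAC subrr add0r.
have := taylor_value_ge fC2 flip x (a *: v).
rewrite -scalemxAr !dotvE enormZ ger0_norm ?(ltW a0) // /K.
have := enorm_ge0 v.
have := ler_norm (- dhess x v v); rewrite normrN.
move: (f (x + a *: v)) (f (x + v)) (f x) (dgrad x v) (enorm v) => F1 F2 F0 g V.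
move: (dhess x v v) => B hB V0 h1 h2.
have gV : 0 <= gamma / 6 * V ^+ 3 by rewrite mulr_ge0 ?exprn_ge0 ?divr_ge0.
have a2 : 0 <= a * (1 - a) by rewrite mulr_ge0 ?subr_ge0 // ltW.
have a3 : a * (a * (gamma / 6 * V ^+ 3) * (1 - a)) >= 0 by rewrite !mulr_ge0 ?subr_ge0 // ltW.
have hB' : 0 <= a ^+ 2 * (`|B| + B) by rewrite mulr_ge0 ?sqr_ge0 //; lra.
have : 0 <= a * (F2 + (lambda / 2 * V ^+ 2 + `|B| / 2 + gamma / 6 * V ^+ 3) * a
    - (F0 + g + lambda / 2 * V ^+ 2)).
  by lra.
by rewrite pmulr_rge0 // subr_ge0.
Qed.

Lemma strongly_convex_hess x v : lambda * enorm v ^+ 2 <= dhess x v v.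
Proof.
apply: (@le_of_le_add_eps _ _ _ (gamma / 3 * enorm v ^+ 3)) => a /andP[a0 a1].
have := strongly_convex_tangent x (a *: v).
have := taylor_value_le fC2 flip x (a *: v).
rewrite -scalemxAr !dotvE enormZ ger0_norm ?(ltW a0) //.
move: (f (x + a *: v)) (f x) (dgrad x v) (enorm v) (dhess x v v) => F1 F0 g V B h1 h2.
have : 0 <= a ^+ 2 * (B + gamma / 3 * V ^+ 3 * a - lambda * V ^+ 2) by lra.
by rewrite pmulr_rge0 ?exprn_gt0 // subr_ge0.
Qed.

End Convex.

(** * The scalar inequalities behind the contraction factor *)

(** Twice the coefficient of gamma left by the estimates, where r = |s|, d = |e| and
    p is the inner product of s and e, against what strong convexity pays for. The
    difference increases as p decreases, so p = r d is the worst case, a cubic form in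
    r and D = a d. For fixed r and D it is concave in a, so its positivity reduces to
    a = 0 and a = 1/3; at both ends it dominates a positive linear form times the
    square of one that vanishes near r = 3/4 D. At r = 3/4 D, a = 1/3 only about
    0.018 D^3 is left: b, tau and the value m = 1/5 in [kernel_value] are chosen near
    the optimum. *)
Lemma scalar_bound (R : realType) (a r d p : R) :
  0 <= r -> 0 <= d -> 0 <= a <= 3^-1 -> p <= r * d ->
  forall b o tau : R, b = 2 / 5 * a -> o = 1 - b -> tau = 3 / 8 * a ->
  2 * (r / 2 * (a * p - r ^+ 2)
       + r * (5 / 2 * (o ^+ 2 / 16 * r ^+ 2 - o / 3 * (b * (p - r ^+ 2))
                       + b ^+ 2 * (d ^+ 2 - 2 * p + r ^+ 2) / 2)
              + r ^+ 2 / 20)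
       + (a - b) * (tau ^+ 2 / 2 - tau ^+ 3 / 3) * d ^+ 3)
  <= a ^+ 2 * d * ((r ^+ 2 - 2 * a * p + a * d ^+ 2) / 2 - a * d ^+ 2 / 24).
Proof.
move=> r0 d0 /andP[a0 a3] hp b o tau -> -> ->.
pose D := a * d.
have D0 : 0 <= D by apply: mulr_ge0.
have rD : 0 <= r * D ^+ 2 by rewrite mulr_ge0 ?sqr_ge0.
have r2D : 0 <= r ^+ 2 * D by rewrite mulr_ge0 ?sqr_ge0.
have r3 : 0 <= r ^+ 3 by apply: exprn_ge0.
have D3 : 0 <= D ^+ 3 by apply: exprn_ge0.
(* The cubic forms at the two ends a = 0 and a = 1/3. *)
pose P0 := 47 / 80 * r ^+ 3 - 3^-1 * (r ^+ 2 * D) - 2/5 * (r * D ^+ 2)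
  + 359/960 * D ^+ 3.
pose P1 := 185 / 432 * r ^+ 3 + 90^-1 * (r ^+ 2 * D) - 11/15 * (r * D ^+ 2)
  + 1463 / 3840 * D ^+ 3.
have hP1 : 0 <= P1.
  have h : 0 <= (77/180 * r + 65 / 100 * D) * (r - 3 / 4 * D) ^+ 2.
    by apply: mulr_ge0; [clear -r0 D0; lra | apply: sqr_ge0].
  rewrite /P1; clear -h rD r2D r3 D3; lra.
have hP0 : 0 <= P0.
  have h : 0 <= (47/80 * r + 50/100 * D) * (r - 72 / 100 * D) ^+ 2.
    by apply: mulr_ge0; [clear -r0 D0; lra | apply: sqr_ge0].
  rewrite /P0; clear -h rD r2D r3 D3; lra.
have h1 : 0 <= (1 - 3 * a) * P0 by apply: mulr_ge0 => //; clear -a3; lra.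
have h2 : 0 <= 3 * a * P1 by rewrite !mulr_ge0.
(* The gain from concavity in a, then the one from p < r d. *)
have h3 : 0 <= 11 / 60 * a * (3^-1 - a) * r ^+ 3 by rewrite !mulr_ge0 //; clear -a3; lra.
have hq : 0 <= (r * d - p) * a * (r * (3^-1 - 8/15 * a) + a * D).
  rewrite mulr_ge0 //; first by rewrite mulr_ge0 // subr_ge0.
  by rewrite addr_ge0 // ?mulr_ge0 //; clear -a3; lra.
rewrite -subr_ge0.
set X := (X in 0 <= X).
have -> : X = (1 - 3 * a) * P0 + 3 * a * P1 + 11 / 60 * a * (3^-1 - a) * r ^+ 3
  + (r * d - p) * a * (r * (3^-1 - 8/15 * a) + a * D).
  by rewrite /X /P0 /P1 /D; field.
by apply: addr_ge0 hq; apply: addr_ge0 h3; apply: addr_ge0.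
Qed.

Lemma weight_bounds (R : realType) (a : R) : 0 <= a <= 3^-1 ->
  [/\ 0 <= 2 / 5 * a, 0 <= 1 - 2 / 5 * a <= 1 & 0 <= 3 / 8 * a <= 1].
Proof. by move=> /andP[a0 a1]; split; lra. Qed.

(** The choice of tau makes the quadratic form in (s, e) with coefficients o / 2,
    - (a - b) / 2 and (a - b) (tau - tau^2 / 2) positive semidefinite. *)
Lemma curvature_weight (R : realType) (a b o tau : R) : 0 <= a <= 3^-1 ->
  b = 2 / 5 * a -> o = 1 - b -> tau = 3 / 8 * a ->
  0 <= (a - b) * (o * (2 * tau - tau ^+ 2) - (a - b)).
Proof.
move=> /andP[a0 a1] -> -> ->.
have h1 : 0 <= a ^+ 2 * (3^-1 - a) by apply: mulr_ge0; [exact: sqr_ge0 | lra].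
have h2 := exprn_ge0 3 a0; have h3 := exprn_ge0 4 a0.
lra.
Qed.

(** Elimination of everything but r, d and p. The letters stand for: F', F0, Fz, Ft the
    values of f at x + s, x, x + e and x + tau e; q_, g_ and ge' its derivatives at
    x + s, x and x + tau e; A__ and N__ the Hessian at x and the error of its
    approximation, as bilinear forms in s and e. The gap is then at
    most its claimed value plus
      - lambda / 2 (r^2 - 2 a p + a d^2) + mu a^2 d^2 / 4 + gamma G,
    and [scalar_bound] compares G with the first two terms. *)
Lemma step_algebra (R : realType) (gamma lambda mu a b o tau r d p : R)
    (F' Fz F0 Ft qe qs ge' ge gs Ass Ase Aee Nss Nse Nee : R) :
  0 <= gamma -> 0 <= a <= 3^-1 ->
  b = 2 / 5 * a -> o = 1 - b -> tau = 3 / 8 * a ->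
  6 * mu * a <= lambda -> gamma * a ^+ 2 * d <= 2 * lambda ->
  0 <= r -> 0 <= d -> p <= r * d ->
  gs + (Ass + Nss) + gamma / 2 * r * r ^+ 2 = 0 ->
  ge + (Ase + Nse) + gamma / 2 * r * p = 0 ->
  F' + (qe - qs) + lambda / 2 * (d ^+ 2 - 2 * p + r ^+ 2) <= Fz ->
  Ft + (1 - tau) * ge' + lambda / 2 * ((1 - tau) * d) ^+ 2 <= Fz ->
  F0 + ge + (tau - tau ^+ 2 / 2) * Aee
     - (tau ^+ 2 / 2 - tau ^+ 3 / 3) * (gamma * d ^+ 3) <= Ft + (1 - tau) * ge' ->
  o * (F' - F0 - gs - Ass / 2) - (b * (qe - qs) - b * (ge - gs) - b * (Ase - Ass))
    <= gamma * r * ((o ^+ 2 / 16 * r ^+ 2 - o / 3 * (b * (p - r ^+ 2))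
          + b ^+ 2 * (d ^+ 2 - 2 * p + r ^+ 2) / 2) / (2 * 5^-1) + 5^-1 / 4 * r ^+ 2) ->
  lambda * (o ^+ 2 * r ^+ 2 - 2 * (o * (a - b)) * p + (a - b) ^+ 2 * d ^+ 2)
    <= o ^+ 2 * Ass - 2 * (o * (a - b)) * Ase + (a - b) ^+ 2 * Aee ->
  lambda * d ^+ 2 <= Aee ->
  0 <= 2 ^+ 2 * Nss - 2 * (2 * a) * Nse + a ^+ 2 * Nee ->
  Nee <= mu * d ^+ 2 ->
  F' - Fz <= (1 - a) * (F0 - Fz).
Proof.
move=> gamma0 a01 eb eo et mua gad r0 d0 pd sts ste I1 I2 I2' I3 A1 A2 N1 N2.
have [a0 a1] := andP a01.
have sca := scalar_bound r0 d0 a01 pd eb eo et.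
have curv := curvature_weight a01 eb eo et.
have b0 : 0 <= b by rewrite eb; clear -a0; lra.
have o0 : 0 < o by rewrite eo eb; clear -a1; lra.
have ab0 : 0 <= a - b by rewrite eb; clear -a0; lra.
have J1 := ler_wpM2l b0 I1.
have J2 := ler_wpM2l ab0 I2.
have J2' := ler_wpM2l ab0 I2'.
have JN := ler_wpM2l (sqr_ge0 a) N2.
have Jt := congr1 ( *%R a) ste.
have hA : lambda * (o / 2 * r ^+ 2 - (a - b) * p + (a - b) * (tau - tau ^+ 2 / 2) * d ^+ 2)
   <= o / 2 * Ass - (a - b) * Ase + (a - b) * (tau - tau ^+ 2 / 2) * Aee.
  have c := mulr_ge0 curv (_ : 0 <= Aee - lambda * d ^+ 2).
  rewrite subr_ge0 in c; have {}c := c A2.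
  rewrite -subr_ge0 -(pmulr_rge0 _ o0); clear -c A1; lra.
pose X := (r ^+ 2 - 2 * a * p + a * d ^+ 2) / 2 - a * d ^+ 2 / 24.
have X0 : 0 <= X.
  have h1 : 0 <= a * (r * d - p) by rewrite mulr_ge0 // subr_ge0.
  have h2 := sqr_ge0 (r - a * d).
  have h3 : 0 <= a * (11 / 12 - a) * d ^+ 2.
    apply: mulr_ge0 (sqr_ge0 _); apply: mulr_ge0 => //; clear -a1; lra.
  rewrite /X; clear -h1 h2 h3; lra.
have gX := ler_wpM2l gamma0 sca.
have lX := ler_wpM2r X0 gad.
have mX : 0 <= a * d ^+ 2 * (lambda - 6 * mu * a).
  by rewrite !mulr_ge0 ?sqr_ge0 // subr_ge0.
set G := (X in 2 * X) in gX.
have hQ : - (lambda / 2) * (r ^+ 2 - 2 * a * p + a * d ^+ 2) + a ^+ 2 * mu * d ^+ 2 / 4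
   + gamma * G <= 0.
  by move: gX lX mX; rewrite /X; clear; lra.
move: hQ sts Jt J1 J2 J2' I3 hA N1 JN; rewrite /G eo; clear; lra.
Qed.

(** * One step of the method *)

Section CubicStep.
Variables (R : realType) (n : nat) (f : 'cV[R]_n -> R) (gamma mu : R).
Variables (H : 'M[R]_n) (x s : 'cV[R]_n).
Hypothesis fC2 : twice_continuously_differentiable f.
Hypothesis flip : hessian_lipschitz gamma f.
Hypothesis gamma0 : 0 <= gamma.
Hypothesis Hsym : H^T = H.
Hypothesis smin : minimizer (cubic_model f H gamma x) (x + s).
Hypothesis HA0 : loewner_le 0 (H - hess f x).
Hypothesis HAmu : loewner_le (H - hess f x) mu%:M.
Implicit Types v z : 'cV[R]_n.
Local Notation dgrad x v := (dotv (grad f x) v).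
Local Notation dhess x u v := (dotv (hess f x *m u) v).
Local Notation err u v := (dotv ((H - hess f x) *m u) v).

Lemma dotv_mulmxC (M : 'M[R]_n) u v : M^T = M -> dotv (M *m u) v = dotv (M *m v) u.
Proof.
move=> Ms.
have dE (a b : 'cV[R]_n) : dotv a b = (a^T *m b) 0 0.
  by rewrite mxE; apply: eq_bigr => i _; rewrite mxE.
by rewrite dE trmx_mul Ms -mulmxA -dE dotvC.
Qed.

Lemma err_ge0 v : 0 <= err v v.
Proof. by have := HA0 v; rewrite subr0. Qed.

Lemma err_le v : err v v <= mu * enorm v ^+ 2.
Proof.
have := HAmu v; rewrite mulmxBl mul_scalar_mx !dotvE -enorm_sqr subr_ge0; exact.
Qed.

Lemma err_sym u v : err u v = err v u.
Proof.
by rewrite !mulmxBl !dotvE (dotv_mulmxC _ _ Hsym) (hess_sym fC2 flip).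
Qed.

Lemma dotvH u v : dotv (H *m u) v = dhess x u v + err u v.
Proof. by rewrite -dotvDl -mulmxDl addrC subrK. Qed.

Lemma cubic_modelE v : cubic_model f H gamma x (x + v)
  = f x + dgrad x v + dotv (H *m v) v / 2 + gamma / 6 * enorm v ^+ 3.
Proof.
rewrite /cubic_model (_ : x + v - x = v); last by rewrite addrAC subrr add0r.
by rewrite [2^-1 * _]mulrC.
Qed.

(** First order optimality, without differentiating the cubed norm: at |s + h w| = P
    one has P^3 - r^3 - 3/2 r (P^2 - r^2) = (P - r)^2 (P + r / 2) = O(h^2), so along
    every direction the model is below its minimum plus h times the claimed slope
    plus O(h^2). *)
Lemma cubic_model_stationary v :
  dgrad x v + dotv (H *m s) v + gamma / 2 * enorm s * dotv s v = 0.
Proof.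
suff le w : 0 <= dgrad x w + dotv (H *m s) w + gamma / 2 * enorm s * dotv s w.
  have := le (- v); have := le v; rewrite !dotvE.
  move: (dgrad x v) (dotv (H *m s) v) (enorm s) (dotv s v) => a b c d; lra.
pose K := `|dotv (H *m w) w| / 2 + gamma / 6 * (3 / 2 * enorm s * enorm w ^+ 2
  + enorm w ^+ 2 * (3 / 2 * enorm s + enorm w)).
apply: (@le_of_le_add_eps _ _ _ K) => h /andP[h0 h1].
have := smin (x + (s + h *: w)); rewrite !cubic_modelE.
rewrite mulmxDr -scalemxAr !dotvE (dotv_mulmxC w s Hsym).
have e2 : enorm (s + h *: w) ^+ 2
    = enorm s ^+ 2 + 2 * h * dotv s w + h ^+ 2 * enorm w ^+ 2.
  by rewrite enorm_sqr !dotvE (dotvC w s) -!enorm_sqr; ring.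
have up : enorm (s + h *: w) <= enorm s + h * enorm w.
  by apply: (le_trans (enormD_le _ _)); rewrite enormZ gtr0_norm.
have lo : enorm s <= enorm (s + h *: w) + h * enorm w.
  have := enormD_le (s + h *: w) (- (h *: w)).
  by rewrite addrK enormN enormZ gtr0_norm.
have := ler_norm (dotv (H *m w) w); rewrite /K.
move: e2 up lo (enorm_ge0 s) (enorm_ge0 w) (enorm_ge0 (s + h *: w)).
move: (enorm (s + h *: w)) (enorm s) (enorm w) (dotv s w) => P r W q.
move: (f x) (dgrad x s) (dgrad x w) (dotv (H *m s) s) (dotv (H *m s) w) (dotv (H *m w) w).
move=> F gs gw Hss Hsw Hww e2 up lo r0 W0 P0 hH hm.
have hW0 : 0 <= h * W by rewrite mulr_ge0 // ltW.
have sq : (P - r) ^+ 2 <= h ^+ 2 * W ^+ 2.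
  rewrite -exprMn -real_normK ?num_real // ler_sqr ?nnegrE //.
  by rewrite ler_norml; lra.
have cub : P ^+ 3 <= r ^+ 3 + 3 / 2 * r * (2 * h * q + h ^+ 2 * W ^+ 2)
     + h ^+ 2 * W ^+ 2 * (3 / 2 * r + W).
  have : (P - r) ^+ 2 * (P + r / 2) <= h ^+ 2 * W ^+ 2 * (3 / 2 * r + W).
    apply: ler_pM => //; [exact: sqr_ge0 | by lra |].
    have : h * W <= W by rewrite ler_piMl.
    lra.
  have : r * P ^+ 2 = r * (r ^+ 2 + 2 * h * q + h ^+ 2 * W ^+ 2) by rewrite e2.
  lra.
have {}cub : gamma / 6 * P ^+ 3 <= gamma / 6 * (r ^+ 3 + 3 / 2 * r * (2 * h * q + h ^+ 2 * W ^+ 2)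
     + h ^+ 2 * W ^+ 2 * (3 / 2 * r + W)) by rewrite ler_wpM2l ?divr_ge0.
have hH2 : h ^+ 2 * Hww <= h ^+ 2 * `|Hww| by rewrite ler_wpM2l ?sqr_ge0.
rewrite -(pmulr_rge0 _ h0).
move: hm cub hH2; lra.
Qed.

(** The model lies above f at x + s and, at x + a e, exceeds f by at most
    mu / 2 |a e|^2 + gamma / 3 |a e|^3; convexity bounds f (x + a e). *)
Lemma convex_step e (a : R) : strongly_convex 0 f -> 0 <= a <= 1 ->
  f (x + s) - f (x + e) <= (1 - a) * (f x - f (x + e))
    + mu * a ^+ 2 / 2 * enorm e ^+ 2 + gamma * a ^+ 3 / 3 * enorm e ^+ 3.
Proof.
move=> fconv a01; have [a0 a1] := andP a01.
have cvx := fconv (x + e) x a a01.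
have ae : a *: (x + e) + (1 - a) *: x = x + a *: e.
  by rewrite scalerDr scalerBl scale1r addrC addrA subrK.
have hs := taylor_value_le fC2 flip x s.
have he := taylor_value_ge fC2 flip x (a *: e).
have E0 := err_ge0 s.
have E1 := err_le (a *: e).
have := smin (x + a *: e); rewrite !cubic_modelE !dotvH.
move: he E1 cvx; rewrite ae !enormZ !(ger0_norm a0) => he E1 cvx.
move: (f (x + s)) (f (x + a *: e)) (f (x + e)) (f x) hs he cvx E0 E1.
move: (dgrad x s) (dgrad x (a *: e)) (dhess x s s) (dhess x (a *: e) (a *: e)).
move: (err s s) (err (a *: e) (a *: e)) (enorm s) (enorm e).
move=> *; lra.
Qed.

(** The three inequalities listed at the top and the optimality condition, reduced
    to relations between inner products and handed to [step_algebra]. *)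
Lemma strongly_convex_step e (lambda a : R) :
  strongly_convex lambda f -> 0 <= a <= 3^-1 ->
  6 * mu * a <= lambda -> gamma * a ^+ 2 * enorm e <= 2 * lambda ->
  f (x + s) - f (x + e) <= (1 - a) * (f x - f (x + e)).
Proof.
move=> fconv a01 mua gad; have [a0 a1] := andP a01.
pose b := 2 / 5 * a; pose tau := 3 / 8 * a; pose o := 1 - b.
have [b0 o01 tau01] := weight_bounds a01; rewrite -/b -/tau -/o in b0 o01 tau01.
have st v : dgrad x v + (dhess x s v + err s v) + gamma / 2 * enorm s * dotv s v = 0.
  by have := cubic_model_stationary v; rewrite dotvH.
have sts := st s; have ste := st e.
have I1 := strongly_convex_tangent fC2 flip gamma0 fconv (x + s) (e - s).
rewrite (_ : x + s + (e - s) = x + e) in I1; last by rewrite addrA addrAC addrK.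
have I2 := strongly_convex_tangent fC2 flip gamma0 fconv (x + tau *: e) ((1 - tau) *: e).
rewrite (_ : x + tau *: e + (1 - tau) *: e = x + e) in I2; last first.
  by rewrite -addrA -scalerDl [tau + _]addrC subrK scale1r.
have I2' := ray_value_ge fC2 flip x e tau01.
have I3 := kernel_value fC2 flip gamma0 x s (b *: (e - s)) o01 (m := 5^-1).
have {}I3 := I3 ltac:(by rewrite invr_gt0).
(* The vectors at which the forms A - lambda and N are tested: they complete the
   squares that appear after eliminating the gradient at x. *)
have A1 := strongly_convex_hess fC2 flip gamma0 fconv x (o *: s - (a - b) *: e).
have A2 := strongly_convex_hess fC2 flip gamma0 fconv x e.
have N1 := err_ge0 (2 *: s - a *: e).
have N2 := err_le e.
have es2 : enorm (e - s) ^+ 2 = enorm e ^+ 2 - 2 * dotv s e + enorm s ^+ 2.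
  by rewrite enorm_sqr !dotvE (dotvC e s) -!enorm_sqr; ring.
have q2 : enorm (o *: s - (a - b) *: e) ^+ 2 = o ^+ 2 * enorm s ^+ 2
    - 2 * (o * (a - b)) * dotv s e + (a - b) ^+ 2 * enorm e ^+ 2.
  by rewrite enorm_sqr !dotvE (dotvC e s) -!enorm_sqr; ring.
have form (M : 'M[R]_n) k l u v : dotv (M *m u) v = dotv (M *m v) u ->
    dotv (M *m (k *: u - l *: v)) (k *: u - l *: v)
    = k ^+ 2 * dotv (M *m u) u - 2 * (k * l) * dotv (M *m u) v
      + l ^+ 2 * dotv (M *m v) v.
  move=> Muv; rewrite mulmxBr -!scalemxAr !dotvE -Muv; ring.
rewrite form ?(hess_sym fC2 flip _ e s) // in A1.
rewrite q2 in A1.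
rewrite form in N1; last exact: err_sym.
rewrite dotvDr dotvNr es2 in I1.
rewrite !dotvZr enormZ ger0_norm in I2; last by rewrite subr_ge0; case/andP: tau01.
rewrite -scalemxAr mulmxBr !dotvE (hess_sym fC2 flip x e s) -!enorm_sqr in I3.
rewrite enormZ (ger0_norm b0) exprMn es2 in I3.
rewrite -!enorm_sqr in sts.
exact: (step_algebra gamma0 a01 erefl erefl erefl mua gad (enorm_ge0 s)
  (enorm_ge0 e) (dotv_le s e) sts ste I1 I2 I2' I3 A1 A2 N1 N2).
Qed.
End CubicStep.

(** * The rate and the recursion *)

(** A term of the minimum with zero denominator is infinite, and the inequality it
    stands for is then trivial. *)
Lemma rate_spec (R : realType) (lambda mu gamma d : R) :
  0 < lambda -> 0 <= mu -> 0 <= gamma -> 0 <= d ->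
  let a := rate lambda mu gamma d in
  [/\ 0 <= a <= 3^-1, 6 * mu * a <= lambda & gamma * a ^+ 2 * d <= 2 * lambda].
Proof.
move=> l0 mu0 gamma0 d0; rewrite /rate.
set m1 := (_ / (6 * mu)%:E)%E; set m2 := sqrte _; set m := Order.min _ _.
have div_real (x y : R) : 0 < y -> (x%:E / y%:E)%E = (x / y)%:E.
  by move=> y0; rewrite inver gt_eqF.
have m1E : mu != 0 -> m1 = (lambda / (6 * mu))%:E.
  by move=> mu1; rewrite /m1 div_real // mulr_gt0 // lt_neqAle eq_sym mu1.
have m2E : gamma * d != 0 -> m2 = (Num.sqrt (2 * lambda / (gamma * d)))%:E.
  by move=> gd; rewrite /m2 div_real // lt_neqAle eq_sym gd mulr_ge0.
have m10 : (0 <= m1)%E.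
  have [z|/m1E ->] := eqVneq mu 0; last by rewrite lee_fin divr_ge0 ?mulr_ge0 // ltW.
  by rewrite /m1 z mulr0 inver eqxx mulry gtr0_sg // mul1e.
have m20 : (0 <= m2)%E by exact: sqrte_ge0.
have mle : (m <= (3^-1)%:E)%E by rewrite ge_min lexx.
have m0 : (0 <= m)%E by rewrite !le_min m10 m20 lee_fin invr_ge0 ler0n.
have mfin : m \is a fin_num.
  by rewrite ge0_fin_numE // (le_lt_trans mle) // ltry.
have le1 : (m <= m1)%E by rewrite !ge_min lexx !orbT.
have le2 : (m <= m2)%E by rewrite !ge_min lexx !orbT.
have [a ma] : exists a, m = a%:E by exists (fine m); rewrite fineK.
move: mle m0 le1 le2; rewrite ma !lee_fin /= => mle m0 le1 le2.
split; first by rewrite m0.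
  have [->|mu1] := eqVneq mu 0; first by rewrite mulr0 mul0r ltW.
  move: le1; rewrite m1E // lee_fin ler_pdivlMr 1?mulrC //.
  by rewrite mulr_gt0 // lt_neqAle eq_sym mu1.
have [gd|gd] := eqVneq (gamma * d) 0.
  by rewrite mulrAC gd mul0r mulr_ge0 // ltW.
have gd0 : 0 < gamma * d by rewrite lt_neqAle eq_sym gd mulr_ge0.
move: le2; rewrite m2E // lee_fin => le2.
have : a ^+ 2 <= 2 * lambda / (gamma * d).
  rewrite -[leRHS]sqr_sqrtr; last by rewrite divr_ge0 ?mulr_ge0 // ltW.
  by rewrite ler_sqr ?nnegrE ?sqrtr_ge0.
by rewrite ler_pdivlMr // mulrC mulrAC.
Qed.

Lemma unroll_decay (R : realType) (gap c alpha : nat -> R) :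
  alpha 0%N = 1 -> (forall t, (1 <= t)%N -> 0 < alpha t < 1) ->
  (forall t, gap t.+1 <= (1 - alpha t) * gap t + c t) ->
  forall t, gap t.+1 <= decay alpha t * \sum_(0 <= i < t.+1) c i / decay alpha i.
Proof.
move=> a0 a1 hgap.
have dpos t : 0 < decay alpha t.
  rewrite /decay big_nat; apply: prodr_gt0 => i /andP[i1 _].
  by rewrite subr_gt0; case/andP: (a1 i i1).
elim=> [|t IH].
  have := hgap 0%N; rewrite a0 subrr mul0r add0r big_nat1.
  by rewrite mulrCA divff ?mulr1 // gt_eqF.
have dS : decay alpha t.+1 = decay alpha t * (1 - alpha t.+1).
  by rewrite /decay big_nat_recr.
rewrite big_nat_recr //= mulrDr mulrCA divff ?mulr1 ?gt_eqF //.
apply: (le_trans (hgap _)); rewrite lerD2r dS -mulrA mulrCA ler_wpM2l //.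
by rewrite subr_ge0 ltW //; case/andP: (a1 t.+1 isT).
Qed.

Unset Implicit Arguments.

Theorem theorem2 (R : realType) (n : nat) (f : 'cV[R]_n -> R) (gamma : R)
    (xstar : 'cV[R]_n) (H : nat -> 'M[R]_n) (x : nat -> 'cV[R]_n)
    (mu : nat -> R) (mu_u : R)
    (f_C2 : twice_continuously_differentiable f)
    (f_lip : hessian_lipschitz gamma f)
    (xstar_min : minimizer f xstar)
    (x_INCR : INCR f (fun _ => gamma) H x)
    (H_approx : forall t : nat,
      loewner_le 0 (H t - hess f (x t)) /\
      loewner_le (H t - hess f (x t)) (mu t)%:M)
    (mu_u_ge0 : 0 <= mu_u)
    (mu_bound : forall t : nat, 0 <= mu t <= mu_u) :
  (forall lambda : R, 0 < lambda -> strongly_convex lambda f ->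
     forall t : nat,
       f (x t.+1) - f xstar <=
         (1 - rate lambda (mu t) gamma (enorm (x t - xstar)))
         * (f (x t) - f xstar))
  /\
  (strongly_convex 0 f ->
     forall alpha : nat -> R,
       alpha 0%N = 1 ->
       (forall t : nat, (1 <= t)%N -> 0 < alpha t < 1) ->
       forall t : nat,
         f (x t.+1) - f xstar <=
           decay alpha t *
           (\sum_(0 <= i < t.+1)
               mu i * alpha i ^+ 2 * enorm (x i - xstar) ^+ 2 / decay alpha i
            + gamma * \sum_(0 <= i < t.+1)
               (alpha i ^+ 3 * enorm (x i - xstar) ^+ 3
                / (3 * decay alpha i)))).
Proof.
have gamma0 : 0 <= gamma by have [] := x_INCR 0%N.
have Hsym t : (H t)^T = H t by have [] := x_INCR t.
have xmin t : minimizer (cubic_model f (H t) gamma (x t)) (x t + (x t.+1 - x t)).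
  by rewrite addrC subrK; have [] := x_INCR t.
have steps t : x t + (x t.+1 - x t) = x t.+1 by rewrite addrC subrK.
have toxs t : x t + (xstar - x t) = xstar by rewrite addrC subrK.
have dist t : enorm (xstar - x t) = enorm (x t - xstar) by rewrite -enormN opprB.
split=> [lambda l0 fconv t|fconv alpha alpha0 alpha1].
  have [H0 H1] := H_approx t; have /andP[mu0 _] := mu_bound t.
  have := rate_spec l0 mu0 gamma0 (enorm_ge0 (x t - xstar)).
  move: (rate _ _ _ _) => a [a01 a_mu]; rewrite -dist => a_gamma.
  have := strongly_convex_step f_C2 f_lip gamma0 (Hsym t) (xmin t) H0 H1
    fconv a01 a_mu a_gamma.
  by rewrite steps toxs.
pose c t := mu t * alpha t ^+ 2 * enorm (x t - xstar) ^+ 2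
  + gamma * (alpha t ^+ 3 * enorm (x t - xstar) ^+ 3 / 3).
have step t : f (x t.+1) - f xstar <= (1 - alpha t) * (f (x t) - f xstar) + c t.
  have [H0 H1] := H_approx t; have /andP[mu0 _] := mu_bound t.
  have a01 : 0 <= alpha t <= 1.
    case: t {H0 H1 mu0} => [|t]; first by rewrite alpha0 ler01 lexx.
    by have /andP[/ltW -> /ltW ->] := alpha1 t.+1 isT.
  have := convex_step f_C2 f_lip (xmin t) H0 H1 (xstar - x t) fconv a01.
  rewrite steps toxs dist /c => /le_trans; apply.
  have : 0 <= mu t * alpha t ^+ 2 * enorm (x t - xstar) ^+ 2.
    by apply: mulr_ge0 (sqr_ge0 _); apply: mulr_ge0 (sqr_ge0 _).
  move: (f (x t)) (f xstar) (enorm (x t - xstar)) => F Fs D; lra.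
move=> t; have := unroll_decay alpha0 alpha1 step t => /le_trans; apply.
rewrite le_eqVlt; apply/orP; left; apply/eqP; congr (_ * _).
rewrite mulr_sumr -big_split /=; apply: eq_bigr => i _.
by rewrite /c mulrDl invfM; ring.
Qed.
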